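(* Let $M\in\mathbb R$ and let $\Phi_c$, $c>0$, be the profile of mass parameter $M$ defined in the context. Then, as $c\to\infty$, $$\frac1{\sqrt c}\,\Phi_c\!\left(\frac y{\sqrt c}\right)\longrightarrow\mathcal U_M(y):=\frac{e^M-1}{1+(e^M-1)y}$$ uniformly for $y\in[0,1]$, at rate $e^{-\pi^2c}$ (i.e. the supremum over $y\in[0,1]$ of the absolute difference is $O(e^{-\pi^2c})$). For comparison, let $u_0\in L^1(0,\infty)$ be supported in $[0,R_0]$ with $\int_0^\infty u_0=M$, fix $L\ge R_0$, and let $u^L$ be the Hopf--Cole solution of the viscous Burgers problem on $(0,L)$ with conservative boundary conditions and datum $u_0$. Then, as $t\to\infty$, $$u^L(x,t)\longrightarrow U_M^L(x):=\frac{e^M-1}{L+(e^M-1)x}\qquad\text{uniformly on }[0,L].$$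
   Context: The function $\varphi$ is the solution of $\varphi_\tau=\varphi_{yy}$ on $(0,1)\times(0,\infty)$, $\varphi(0,\tau)=0$, $\varphi(1,\tau)=1$, $\varphi(y,0)=1$; explicitly $$\varphi(y,\tau)=y+\frac2\pi\sum_{n\ge1}\frac{\sin(n\pi y)}{n}e^{-n^2\pi^2\tau},\qquad \tau>0.$$ For $c>0$ and $0\le\xi\le c^{-1/2}$, $$\Phi_c(\xi)=\sqrt c\,\frac{(e^M-1)\,\varphi_y(\xi\sqrt c,c)}{1+(e^M-1)\,\varphi(\xi\sqrt c,c)}.$$ The interval problem is $u_t-u_{xx}=(u^2)_x$ in $(0,L)\times(0,\infty)$, $u_x=-u^2$ at $x=0$ and at $x=L$, $u(\cdot,0)=u_0$. Its Hopf--Cole solution is $u^L=w^L_x/w^L$, where $w^L>0$ is the classical solution (continuous up to $t=0$) of $w_t=w_{xx}$ in $(0,L)\times(0,\infty)$, $w(0,t)=1$, $w(L,t)=e^M$, $w(x,0)=\exp\left(\int_0^xu_0(z)\,dz\right)$. *)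

(* Defs.v *)
From HB Require Import structures.
From mathcomp Require Import all_boot all_order all_algebra.
From mathcomp Require Import all_classical all_reals all_analysis.
Set Implicit Arguments.
Unset Strict Implicit.
Unset Printing Implicit Defensive.
Import Order.TTheory GRing.Theory Num.Theory.
Import numFieldNormedType.Exports.
Local Open Scope ring_scope.
Local Open Scope classical_set_scope.

Section profile.
Context {R : realType}.

(* The explicit series for the solution on (0,1) of the heat equation with
   boundary values 0 and 1 and initial value 1.  It is meaningful for
   [0 < tau], where it converges and is smooth in [y] on the whole line; hence
   the two-sided [derive1] below is the right derivative also at the endpoints
   [y = 0] and [y = 1]. *)
Definition phi (y tau : R) : R :=
  y + 2 / pi *
      limn (fun N => \sum_(1 <= n < N)
        sin (n%:R * pi * y) / n%:R * expR (- (n%:R ^+ 2 * pi ^+ 2 * tau))).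

Definition phi_y (y tau : R) : R := derive1 (fun z => phi z tau) y.

(* Meaningful for [0 < c] and [0 <= xi <= (Num.sqrt c)^-1]. *)
Definition Phi (M c xi : R) : R :=
  Num.sqrt c * ((expR M - 1) * phi_y (xi * Num.sqrt c) c
                / (1 + (expR M - 1) * phi (xi * Num.sqrt c) c)).

(* [U M 1] is the limit profile on [[0,1]]. *)
Definition U (M L x : R) : R := (expR M - 1) / (L + (expR M - 1) * x).

End profile.

Section interval_problem.
Context {R : realType}.
Notation mu := (@lebesgue_measure R).

(* [w x t] is of class C^{2,1} in the open cylinder and continuous on the closed
   one; its values outside of [[0,L] x [0,+oo[] are irrelevant. *)
Record hopf_cole_potential (L M : R) (u0 : R -> R) (w : R -> R -> R) : Prop := {
  hc_gt0 : forall x t, 0 <= x <= L -> 0 <= t -> 0 < w x t ;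
  hc_continuous :
    {within `[0, L] `*` `[0, +oo[, continuous (fun p : R * R => w p.1 p.2)} ;
  hc_derivable : forall x t, 0 < x < L -> 0 < t ->
    [/\ derivable (fun s => w x s) t 1,
        derivable (fun z => w z t) x 1 &
        derivable (derive1 (fun z => w z t)) x 1] ;
  hc_continuous_t : {within `]0, L[ `*` `]0, +oo[,
    continuous (fun p : R * R => derive1 (fun s => w p.1 s) p.2)} ;
  hc_continuous_x : {within `]0, L[ `*` `]0, +oo[,
    continuous (fun p : R * R => derive1 (fun z => w z p.2) p.1)} ;
  hc_continuous_xx : {within `]0, L[ `*` `]0, +oo[,
    continuous (fun p : R * R => derive1n 2 (fun z => w z p.2) p.1)} ;
  hc_heat : forall x t, 0 < x < L -> 0 < t ->
    derive1 (fun s => w x s) t = derive1n 2 (fun z => w z t) x ;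
  hc_left : forall t, 0 < t -> w 0 t = 1 ;
  hc_right : forall t, 0 < t -> w L t = expR M ;
  hc_init : forall x, 0 <= x <= L ->
    w x 0 = expR (\int[mu]_(z in `]0, x[) u0 z)
}.

(* Derivative relative to [[a,b]]: one-sided at [a] and [b], equal to
   [derive1] (when that exists) in between. *)
Definition derive_itv (a b : R) (f : R -> R) (x : R) : R :=
  lim ((f z - f x) / (z - x) @[z --> within `[a, b] x^']).

Definition hopf_cole (L : R) (w : R -> R -> R) (x t : R) : R :=
  derive_itv 0 L (fun z => w z t) x / w x t.

End interval_problem.

(* Main.v *)
Require Import Defs.
From HB Require Import structures.
From mathcomp Require Import all_boot all_order all_algebra.
From mathcomp Require Import all_classical all_reals all_analysis.
From mathcomp Require Import ring lra zify.
Import Order.TTheory GRing.Theory Num.Theory.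
Import numFieldNormedType.Exports.
Local Open Scope ring_scope.
Local Open Scope classical_set_scope.

Set Implicit Arguments.
Unset Strict Implicit.
Unset Printing Implicit Defensive.

(* Both limits are quotients (a + G) / (b + F) tending to a / b, where F and G
   are a sine series with coefficients O(1) e^{-n^2 s}, hence O(e^{-s}), and its
   termwise derivative.  For [phi] this is the given series.  For the interval
   problem, subtract from [w] its stationary limit; the difference [v] vanishes
   on the lateral boundary, and it is again such a series, up to the boundary,
   which is what gives the one-sided derivatives at 0 and L.  Indeed [v(., 0)]
   is a uniform limit of sine polynomials; the corresponding explicit heat
   solutions converge to [v] by the maximum principle, and their coefficients
   converge because the coefficients of a sine polynomial are at most twice its
   sup norm. *)

(** The datum [v(., 0)] is known only to be continuous, so its own Fourier series need not converge
    uniformly. Arbitrary sine polynomials serve instead: the coefficients of two approximants are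
    compared with each other, which makes them Cauchy without any formula for their limits. The
    representation is claimed only when [4 <= k ^+ 2 * t], with [k] the base frequency. There, with
    [s = k ^+ 2 * t], the quantity n^2 e^{-n^2 s} is at most 2 e^{-s} 2^{-n}, and this one geometric
    majorant yields convergence, termwise differentiability on the whole line and the rate. The
    vanishing of [v] at the two corners is what lets sine polynomials approximate its datum
    uniformly up to the endpoints. *)

Lemma mean_value (R : realType) (f df : R -> R) (x y : R) :
  (forall z : R, is_derive z 1 f (df z)) ->
  exists2 c, `|c - x| <= `|y - x| & f y - f x = df c * (y - x).
Proof.
move=> fdf.
have cf : continuous f.
  by move=> z; apply: differentiable_continuous; apply/derivable1_diffP.
have wcf (a b : R) : {within `[a, b], continuous f}.
  exact: continuous_subspaceT.
have [xy|yx] := leP x y.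
  have [c + E] := MVT_segment xy (fun z _ => fdf z) (wcf _ _).
  rewrite in_itv/= => /andP[xc cy]; exists c => //.
  by rewrite !ger0_norm ?subr_ge0// lerD2r.
have [c + E] := MVT_segment (ltW yx) (fun z _ => fdf z) (wcf _ _).
rewrite in_itv/= => /andP[yc cx]; exists c.
  by rewrite !ler0_norm ?subr_le0// ?(ltW yx)// lerN2 lerD2r.
by rewrite -[LHS]opprB E -mulrN opprB.
Qed.

Lemma cos_lipschitz (R : realType) (x y : R) : `|cos y - cos x| <= `|y - x|.
Proof.
have [c _ ->] := mean_value x y (@is_derive_cos R).
by rewrite normrM ler_piMl// normrN sin_max.
Qed.

Lemma sin_taylor1 (R : realType) (a h : R) :
  `|sin (a + h) - sin a - h * cos a| <= h ^+ 2.
Proof.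
have [c + ->] := mean_value a (a + h) (@is_derive_sin R).
rewrite addrAC subrr add0r => ch.
rewrite [cos c * h]mulrC -mulrBr normrM -real_normK ?num_real// expr2.
by rewrite ler_wpM2l// (le_trans (cos_lipschitz _ _)).
Qed.

(** Allows termwise differentiation of a series without a theorem on uniform convergence of
    derivatives: the quadratic remainders of the terms are simply summed. *)
Lemma is_derive_quadratic (R : realType) (f : R -> R) (x d C : R) :
  (forall h, `|f (x + h) - f x - h * d| <= C * h ^+ 2) -> is_derive x 1 f d.
Proof.
move=> fC.
have C0 : 0 <= C by have := fC 1; rewrite expr1n mulr1; exact: le_trans.
have E : h^-1 *: (f (h *: 1 + x) - f x) @[h --> 0^'] --> d.
  apply/cvgrPdist_le => e e0; near=> h.
  have h0 : h != 0 by near: h; exact: nbhs_dnbhs_neq.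
  have -> : d - h^-1 *: (f (h *: 1 + x) - f x) =
      - (h^-1 * (f (x + h) - f x - h * d)).
    rewrite /GRing.scale/= mulr1 [h + x]addrC; field.
    exact: h0.
  rewrite normrN normrM normfV mulrC ler_pdivrMr ?normr_gt0//.
  rewrite (le_trans (fC h))// -real_normK ?num_real// expr2 mulrA ler_wpM2r//.
  rewrite (@le_trans _ _ ((C + 1) * `|h|)) ?ler_wpM2r// ?lerDl//.
  rewrite -ler_pdivlMl ?ltr_wpDl//.
  near: h; apply: dnbhs0_le; rewrite mulr_gt0 ?invr_gt0 ?ltr_wpDl//.
split; first by apply/cvg_ex; exists d.
exact: cvg_lim E.
Unshelve. all: by end_near. Qed.

(** * Series with a geometric majorant and termwise differentiation of sine series *)

Section geometric_bound.
Context {R : realType}.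
Implicit Types (u : nat -> R) (A : R).

Lemma is_cvg_series_geometric_bound u A :
  (forall n, `|u n| <= A * 2^-1 ^+ n) -> cvgn (series u).
Proof.
move=> uA; apply: normed_cvg.
apply: (@series_le_cvg _ _ (geometric A 2^-1)) => [n|n|n|].
- exact: normr_ge0.
- exact: le_trans (normr_ge0 _) (uA n).
- exact: uA.
- by apply: is_cvg_geometric_series; rewrite ger0_norm ?invr_ge0// invf_lt1// ltr1n.
Qed.

Lemma norm_series_geometric_bound u A :
  (forall n, `|u n| <= A * 2^-1 ^+ n) -> `|limn (series u)| <= A * 2.
Proof.
move=> uA; have A0 : 0 <= A.
  by have := uA 0; rewrite expr0 mulr1; exact: le_trans.
have h1 : `|2^-1 : R| < 1.
  by rewrite ger0_norm ?invr_ge0// invf_lt1// ltr1n.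
have cu := is_cvg_series_geometric_bound uA.
rewrite -lim_norm//; apply: limr_le; first exact: is_cvg_norm.
apply: nearW => N; rewrite (le_trans (ler_norm_sum _ _ _))//.
rewrite (@le_trans _ _ (series (geometric A 2^-1) N))//.
  by apply: ler_sum => n _; exact: uA.
rewrite (le_trans (geometric_le_lim _ _ _ _))// ?invr_gt0//.
have -> : 1 - 2^-1 = 2^-1 :> R by field.
by rewrite invrK.
Qed.

End geometric_bound.

Section sine_series.
Context {R : realType} (k A : R) (a : nat -> R).
Hypothesis aA : forall n, `|a n| * n%:R ^+ 2 <= A * 2^-1 ^+ n.

Definition sine_series (x : R) : R :=
  limn (series (fun n => a n * sin (n%:R * k * x))).

Definition sine_series' (x : R) : R :=
  limn (series (fun n => a n * (n%:R * k) * cos (n%:R * k * x))).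

Lemma sine_series_coef n : `|a n| * n%:R <= A * 2^-1 ^+ n.
Proof.
apply: le_trans (aA n); rewrite ler_wpM2l// expr2 -natrM ler_nat.
by case: n => // n; rewrite leq_pmulr.
Qed.

Lemma sine_series_term x n :
  `|a n * sin (n%:R * k * x)| <= A * 2^-1 ^+ n.
Proof.
apply: le_trans (sine_series_coef n).
case: n => [|n]; first by rewrite !mul0r sin0 !mulr0 normr0.
by rewrite normrM ler_wpM2l// (le_trans (sin_max _))// ler1n.
Qed.

Lemma sine_series'_term x n :
  `|a n * (n%:R * k) * cos (n%:R * k * x)| <= A * `|k| * 2^-1 ^+ n.
Proof.
rewrite normrM (@le_trans _ _ (`|a n * (n%:R * k)|)) ?ler_piMr ?cos_max//.
by rewrite 2!normrM normr_nat mulrA [leRHS]mulrAC ler_wpM2r// sine_series_coef.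
Qed.

Lemma sine_series_le x : `|sine_series x| <= A * 2.
Proof. exact/norm_series_geometric_bound/sine_series_term. Qed.

Lemma sine_series'_le x : `|sine_series' x| <= A * `|k| * 2.
Proof. exact/norm_series_geometric_bound/sine_series'_term. Qed.

(** By [sin_taylor1] the remainder of the n-th term is at most |a n| (n k h)^2; the weight n^2 in
    [aA] is exactly what makes these remainders sum to a multiple of h^2. *)
Lemma is_derive_sine_series (x : R) : is_derive x 1 sine_series (sine_series' x).
Proof.
apply: (@is_derive_quadratic _ _ _ _ (A * k ^+ 2 * 2)) => h.
have c1 y := is_cvg_series_geometric_bound (sine_series_term y).
have c2 := is_cvg_series_geometric_bound (sine_series'_term x).
rewrite -lim_seriesB// -[h * _]lim_seriesZ// -lim_seriesB//; last 2 first.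
- by apply: is_cvg_seriesB.
- by apply: is_cvg_seriesZ.
rewrite mulrAC.
have -> : A * k ^+ 2 * h ^+ 2 * 2 = A * (k * h) ^+ 2 * 2 by ring.
apply: norm_series_geometric_bound => n; rewrite !fctE /GRing.scale/=.
have -> : a n * sin (n%:R * k * (x + h)) - a n * sin (n%:R * k * x) -
   h * (a n * (n%:R * k) * cos (n%:R * k * x)) =
   a n * (sin (n%:R * k * x + n%:R * k * h) - sin (n%:R * k * x) -
     (n%:R * k * h) * cos (n%:R * k * x)) by rewrite [_ * (x + h)]mulrDr; ring.
rewrite normrM (le_trans (ler_wpM2l _ (sin_taylor1 _ _)))//.
have -> : (n%:R * k * h) ^+ 2 = n%:R ^+ 2 * (k * h) ^+ 2 by ring.
by rewrite mulrA [leRHS]mulrAC ler_wpM2r// sqr_ge0.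
Qed.

End sine_series.

(** For n = m + 1 one has n^2 - 1 = m^2 + 2m >= 2m, so [4 <= s] bounds the exponential, apart from
    its factor e^{-s}, by e^{-8m} <= 8^{-m}. Since n <= 2^m, the factor n^2 costs at most 4^m, which
    leaves 2^{-m}. *)
Lemma sqr_expR_le (R : realType) (s : R) (n : nat) : 4 <= s ->
  n%:R ^+ 2 * expR (- (n%:R ^+ 2 * s)) <= 2 * expR (- s) * 2^-1 ^+ n.
Proof.
move=> s4; case: n => [|m].
  by rewrite expr0n/= mul0r !mulr_ge0// expR_ge0.
have E : expR (- (m.+1%:R ^+ 2 * s)) =
    expR (- s) * expR (- ((m.+1%:R ^+ 2 - 1) * s)).
  by rewrite -expRD; congr expR; ring.
have m8 : expR (- ((m.+1%:R ^+ 2 - 1) * s)) <= 8^-1 ^+ m.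
  have -> : 8^-1 ^+ m = (8 ^+ m)^-1 :> R by rewrite exprVn.
  rewrite expRN lef_pV2 ?posrE ?exprn_gt0// ?expR_gt0//.
  rewrite (@le_trans _ _ (expR 8 ^+ m))//.
    by rewrite lerXn2r// ?nnegrE// ?expR_ge0// (le_trans _ (expR_ge1Dx _))// lerDr.
  rewrite -expRM_natl ler_expR -[m.+1]addn1 natrD.
  have m0 : 0 <= m%:R :> R by [].
  have m4 : m%:R * 4 <= m%:R * s by rewrite ler_wpM2l.
  have m2 : 0 <= m%:R * m%:R * s by rewrite !mulr_ge0// (le_trans _ s4).
  nra.
have m2 : m.+1%:R ^+ 2 <= 4 ^+ m :> R.
  have -> : 4 = 2 ^+ 2 :> R by rewrite -natrX.
  rewrite -exprM mulnC exprM lerXn2r// ?nnegrE// ?exprn_ge0// -natrX ler_nat.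
  exact: ltn_expl.
rewrite E mulrCA [2 * _]mulrC -[leRHS]mulrA ler_wpM2l ?expR_ge0//.
have -> : 2 * 2^-1 ^+ m.+1 = 2^-1 ^+ m :> R by rewrite exprS mulrA divff// mul1r.
have -> : 2^-1 ^+ m = 4 ^+ m * 8^-1 ^+ m :> R.
  by rewrite -exprMn; congr (_ ^+ m); field.
by rewrite ler_pM// ?sqr_ge0// expR_ge0.
Qed.

(** * Sine polynomials: discrete orthogonality and Bernstein approximation *)

Section sine_polynomials.
Context {R : realType}.
Implicit Types (a th : R) (p : nat -> R).

Lemma cos_sum a K : (\sum_(j < K) cos (j%:R * a)) * (2 * sin (a / 2)) =
  sin (K%:R * a - a / 2) + sin (a / 2).
Proof.
elim: K => [|K IH]; first by rewrite big_ord0 !mul0r sub0r sinN addNr.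
rewrite big_ord_recr/= mulrDl IH.
have -> : K.+1%:R * a - a / 2 = K%:R * a + a / 2.
  by rewrite -[K.+1]addn1 natrD; field.
by rewrite [in RHS]sinD sinB; ring.
Qed.

(** With a = k pi / N, the closed form of [cos_sum] at K = 2N is sin(2 k pi - a/2) + sin(a/2) = 0.
    The factor 2 sin(a/2) can be cancelled because 0 < a/2 < pi. *)
Lemma cos_sum_root_of_unity N k : (0 < k < N.*2)%N ->
  \sum_(j < N.*2) cos (k%:R * (j%:R * (pi / N%:R))) = 0 :> R.
Proof.
move=> /andP[k0 kN].
have N0 : N%:R != 0 :> R.
  by rewrite pnatr_eq0; case: N kN.
have N0' : 0 < N%:R :> R by rewrite lt0r N0/=.
pose a : R := k%:R * (pi / N%:R).
have /eqP := cos_sum a N.*2.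
have -> : N.*2%:R * a - a / 2 = - (a / 2) + pi *+ 2 *+ k.
  by rewrite /a -[pi *+ 2 *+ k]mulr_natr -[pi *+ 2]mulr_natr -muln2 natrM; field.
rewrite (periodicn (@sinD2pi R)) sinN addNr mulf_eq0 => /orP[/eqP S0|].
  by rewrite -[RHS]S0; apply: eq_bigr => j _; rewrite /a mulrCA.
rewrite mulf_eq0 pnatr_eq0/= => /eqP sa.
suff : 0 < sin (a / 2) by rewrite sa ltxx.
have a0 : 0 < a by rewrite mulr_gt0 ?ltr0n// divr_gt0 ?pi_gt0.
apply: sin_gt0_pi; rewrite divr_gt0// /a/=.
have -> : k%:R * (pi / N%:R) / 2 = pi * (k%:R / N.*2%:R) :> R.
  by rewrite -muln2 natrM; field.
rewrite gtr_pMr ?pi_gt0// ltr_pdivrMr ?mul1r ?ltr_nat// ltr0n double_gt0.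
by case: N kN {N0 N0' a a0 sa}.
Qed.

Lemma sin_orthogonal N m n : (m < N)%N -> (0 < n < N)%N ->
  \sum_(j < N.*2) sin (m%:R * (j%:R * (pi / N%:R))) *
                  sin (n%:R * (j%:R * (pi / N%:R))) =
  if m == n then N%:R else 0 :> R.
Proof.
move=> mN /andP[n0 nN].
pose x (j : nat) : R := j%:R * (pi / N%:R).
pose S (k : nat) : R := \sum_(j < N.*2) cos (k%:R * x j).
have S0 k : (0 < k < N.*2)%N -> S k = 0 by exact: cos_sum_root_of_unity.
(* Writing the two frequencies as [i + l] and [i] keeps the product-to-sum formula free of
   subtraction on [nat]. *)
have E i l : \sum_(j < N.*2) sin ((i + l)%:R * x j) * sin (i%:R * x j) =
    (S l - S (i + l + i)%N) / 2.
  rewrite -sumrB mulr_suml; apply: eq_bigr => j _.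
  have -> : l%:R * x j = (i + l)%:R * x j - i%:R * x j by rewrite natrD; ring.
  have -> : (i + l + i)%:R * x j = (i + l)%:R * x j + i%:R * x j.
    by rewrite (natrD _ (i + l)); ring.
  by rewrite cosB cosD; field.
have [->|nm] := eqVneq m n.
  have -> : \sum_(j < N.*2) sin (n%:R * x j) * sin (n%:R * x j) =
            (S 0%N - S (n + n)%N) / 2.
    by rewrite -{1}[n]addn0 E addn0.
  rewrite (S0 (n + n)%N) ?addnn ?double_gt0 ?ltn_double ?n0//.
  rewrite /S (eq_bigr (fun=> 1)) => [|j _]; last by rewrite mul0r cos0.
  by rewrite sumr_const card_ord -muln2 natrM subr0; field.
have [nlm|mln] := ltnP n m.
  by rewrite -(subnKC (ltnW nlm)) E !S0 ?subrr ?mul0r//; lia.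
have {mln nm}mn : (m < n)%N by rewrite ltn_neqAle nm.
have [->|m0] := posnP m.
  by rewrite big1 // => j _; rewrite mul0r sin0 mul0r.
under eq_bigr do rewrite mulrC.
by rewrite -(subnKC (ltnW mn)) E !S0 ?subrr ?mul0r//; lia.
Qed.

Lemma sin_natr_2piB n th : sin (n%:R * (pi *+ 2 - th)) = - sin (n%:R * th).
Proof.
rewrite mulrBr [_ * (_ *+ 2)]mulr_natl addrC -sinN.
by rewrite (periodicn (@sinD2pi R)).
Qed.

(* The discrete orthogonality of the sines at the nodes [j pi / N] recovers the
   coefficients from values of the sum, with no integral. *)
Lemma sine_coef_le N p (E : R) :
  (forall th, 0 <= th <= pi -> `|\sum_(n < N) p n * sin (n%:R * th)| <= E) ->
  forall n, (0 < n < N)%N -> `|p n| <= 2 * E.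
Proof.
move=> pE n n0N; have /andP[n0 nN] := n0N.
have N0 : 0 < N%:R :> R by rewrite ltr0n (leq_trans _ nN).
have pi0 : 0 < pi / N%:R :> R by rewrite divr_gt0 ?pi_gt0.
pose P th := \sum_(n < N) p n * sin (n%:R * th).
pose x (j : nat) : R := j%:R * (pi / N%:R).
(* The nodes cover a whole period but the bound is given on [[0, pi]] only; [P] is odd and 2
   pi-periodic, so the remaining nodes are reflected by th -> 2 pi - th. *)
have PE j : (j < N.*2)%N -> `|P (x j)| <= E.
  move=> jN; have [xpi|pix] := leP (x j) pi.
    by apply: pE; rewrite xpi mulr_ge0// ltW.
  have -> : P (x j) = - P (pi *+ 2 - x j).
    by rewrite /P -sumrN; apply: eq_bigr => i _; rewrite sin_natr_2piB mulrN opprK.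
  rewrite normrN; apply: pE; apply/andP; split.
    rewrite subr_ge0 /x mulrCA -[pi *+ 2]mulr_natr ler_wpM2l ?pi_ge0//.
    by rewrite ler_pdivrMr// -natrM ler_nat mul2n ltnW.
  by rewrite mulr2n lerBlDr lerD2l ltW.
have sumP : \sum_(j < N.*2) P (x j) * sin (n%:R * x j) = p n * N%:R.
  under eq_bigr do rewrite /P mulr_suml.
  rewrite exchange_big/= (bigD1 (Ordinal nN))//= [X in _ + X]big1 => [|i iN].
    under eq_bigr do rewrite -mulrA.
    by rewrite -mulr_sumr sin_orthogonal// eqxx addr0.
  under eq_bigr do rewrite -mulrA.
  rewrite -mulr_sumr sin_orthogonal// ifN ?mulr0//.
rewrite -(ler_pM2r N0) -[X in _ * X <= _]gtr0_norm// -normrM -sumP.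
rewrite (le_trans (ler_norm_sum _ _ _))//.
rewrite (@le_trans _ _ (\sum_(j < N.*2) E))//.
  apply: ler_sum => j _; rewrite normrM (le_trans _ (PE j (ltn_ord j)))//.
  by rewrite ler_piMr// sin_max.
rewrite sumr_const card_ord -muln2 -[E *+ _]mulr_natr natrM.
by have -> : 2 * E * N%:R = E * (N%:R * 2) by ring.
Qed.

(** The vanishing of [p] from [N] on lets sums of different lengths be widened to a common one, and
    lets a polynomial be read as a [sine_series] with the same coefficients. *)
Definition is_sine_poly (f : R -> R) := exists N p,
  (forall n, (N <= n)%N -> p n = 0) /\
  (forall th, f th = \sum_(n < N) p n * sin (n%:R * th)).

Lemma sine_poly_widen N N' p th : (forall n, (N <= n)%N -> p n = 0) ->
  (N <= N')%N ->
  \sum_(n < N) p n * sin (n%:R * th) = \sum_(n < N') p n * sin (n%:R * th).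
Proof.
move=> p0 NN'; rewrite (big_ord_widen _ (fun n => p n * sin (n%:R * th)) NN').
rewrite [RHS](bigID (fun n : 'I_N' => (n < N)%N))/= [X in _ + X]big1 ?addr0//.
by move=> i; rewrite -leqNgt => /p0 ->; rewrite mul0r.
Qed.

Lemma is_sine_polyD f g :
  is_sine_poly f -> is_sine_poly g -> is_sine_poly (fun th => f th + g th).
Proof.
move=> [N [p [p0 fp]]] [N' [p' [p'0 gp']]].
exists (maxn N N'), (fun n => p n + p' n); split=> [n|th].
  by rewrite geq_max => /andP[Nn N'n]; rewrite p0// p'0// addr0.
rewrite fp gp' (sine_poly_widen th p0 (leq_maxl N N')).
rewrite (sine_poly_widen th p'0 (leq_maxr N N')) -big_split/=.
by apply: eq_bigr => i _; rewrite mulrDl.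
Qed.

Lemma is_sine_polyZ a f : is_sine_poly f -> is_sine_poly (fun th => a * f th).
Proof.
move=> [N [p [p0 fp]]]; exists N, (fun n => a * p n); split=> [n Nn|th].
  by rewrite p0// mulr0.
by rewrite fp mulr_sumr; apply: eq_bigr => i _; rewrite mulrA.
Qed.

Lemma eq_is_sine_poly f g : f =1 g -> is_sine_poly f -> is_sine_poly g.
Proof. by move=> /funext ->. Qed.

Lemma is_sine_poly_sin n : is_sine_poly (fun th => sin (n%:R * th)).
Proof.
exists n.+1, (fun i => (i == n)%:R); split=> [i ni|th].
  by rewrite gtn_eqF.
rewrite (bigD1 ord_max)//= eqxx mul1r big1 ?addr0// => i.
by rewrite -val_eqE/= => /negPf ->; rewrite mul0r.
Qed.

(** Since 2 sin(n th) cos th = sin((n+1) th) + sin((n-1) th), the class is stable under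
    multiplication by [cos]; hence [sin th] times any polynomial in [cos th] belongs to it. *)
Lemma is_sine_poly_mul_cos f :
  is_sine_poly f -> is_sine_poly (fun th => f th * cos th).
Proof.
have sc n : is_sine_poly (fun th => sin (n%:R * th) * cos th).
  case: n => [|n].
    apply: eq_is_sine_poly (is_sine_poly_sin 0) => th.
    by rewrite !mul0r sin0 mul0r.
  apply: eq_is_sine_poly (is_sine_polyZ 2^-1
    (is_sine_polyD (is_sine_poly_sin n.+2) (is_sine_poly_sin n))) => th.
  have -> : n.+2%:R * th = n.+1%:R * th + th by rewrite -[n.+2]addn1 natrD; ring.
  have -> : n%:R * th = n.+1%:R * th - th by rewrite -[n.+1]addn1 natrD; ring.
  by rewrite sinD sinB; field.
move=> [N [p [_ fp]]].
apply: (@eq_is_sine_poly (fun th => \sum_(n < N) p n * (sin (n%:R * th) * cos th))).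
  by move=> th; rewrite fp mulr_suml; apply: eq_bigr => n _; rewrite mulrA.
elim: N {fp} => [|N IH].
  apply: eq_is_sine_poly (is_sine_poly_sin 0) => th.
  by rewrite big_ord0 mul0r sin0.
apply: eq_is_sine_poly (is_sine_polyD IH (is_sine_polyZ (p N) (sc N))) => th.
by rewrite big_ord_recr.
Qed.

(* The value at [x] of the [n]-th Bernstein polynomial with nodal values
   [f 0, ..., f n], i.e. the mean of [f] under the binomial law [B(n, x)],
   computed by conditioning on the first trial. *)
Fixpoint bernstein (n : nat) (f : nat -> R) (x : R) : R :=
  if n is m.+1 then
    (1 - x) * bernstein m f x + x * bernstein m (fun k => f k.+1) x
  else f 0.

(** The recursion averages with the weights 1 - x and x, so the operator is positive and fixes
    constants. *)
Lemma bernstein_dist n (f g : nat -> R) (v x : R) : 0 <= x <= 1 ->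
  (forall k, (k <= n)%N -> `|v - f k| <= g k) ->
  `|v - bernstein n f x| <= bernstein n g x.
Proof.
move=> /andP[x0 x1]; elim: n f g => [|n IH] f g fg /=; first exact: fg.
have -> : v - ((1 - x) * bernstein n f x + x * bernstein n (fun k => f k.+1) x) =
  (1 - x) * (v - bernstein n f x) + x * (v - bernstein n (fun k => f k.+1) x).
  by ring.
rewrite (le_trans (ler_normD _ _))// !normrM (ger0_norm x0).
rewrite (@ger0_norm _ (1 - x)) ?subr_ge0//.
apply: lerD; apply: ler_wpM2l; rewrite ?subr_ge0//; apply: IH => k kn.
  exact/fg/leqW.
exact: fg.
Qed.

(** The binomial law has mean n x and variance n x (1 - x), which splits the mean square distance to
    [a]. In the induction, a success in the first trial replaces [a] by [a - 1]. *)
Lemma bernstein_variance n (e C a x : R) :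
  bernstein n (fun k => e + C * (k%:R - a) ^+ 2) x =
  e + C * (n%:R * x * (1 - x) + (n%:R * x - a) ^+ 2).
Proof.
elim: n a => [|n IH] a /=; first by ring.
rewrite IH.
rewrite [X in bernstein n X](_ : _ = fun k => e + C * (k%:R - (a - 1)) ^+ 2).
  by rewrite IH -[n.+1]addn1 natrD; ring.
by apply/funext => k; rewrite -[k.+1]addn1 natrD; ring.
Qed.

Lemma is_sine_poly_bernstein n f :
  is_sine_poly (fun th => sin th * bernstein n f ((1 - cos th) / 2)).
Proof.
elim: n f => [|n IH] f /=.
  apply: eq_is_sine_poly (is_sine_polyZ (f 0) (is_sine_poly_sin 1)) => th.
  by rewrite mul1r mulrC.
have h1 := IH f; have h2 := IH (fun k => f k.+1).
have h3 := is_sine_polyD h1 (is_sine_poly_mul_cos h1).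
have h4 := is_sine_polyD h2 (is_sine_polyZ (-1) (is_sine_poly_mul_cos h2)).
apply: eq_is_sine_poly
  (is_sine_polyD (is_sine_polyZ 2^-1 h3) (is_sine_polyZ 2^-1 h4)) => th.
by field.
Qed.

End sine_polynomials.

(* Measuring the modulus of continuity by [cos] makes the error of a Bernstein
   approximation in the variable [cos th] a binomial variance. *)
Lemma modulus_cos (R : realType) (g : R -> R) (e : R) :
  {within `[0, pi], continuous g} -> 0 < e ->
  exists2 C : R, 0 <= C & forall a b : R, 0 <= a <= pi -> 0 <= b <= pi ->
    `|g a - g b| <= e + C * (cos a - cos b) ^+ 2.
Proof.
move=> gc e0; set A : set R := `[0, pi]%classic.
have gA (a : R) : A a -> \forall b \near a, A b -> `|g a - g b| < e / 2.
  move=> Aa; move/subspace_continuousP : gc => /(_ _ Aa) /cvgrPdist_lt.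
  by apply; rewrite divr_gt0.
pose P (C : R) (p : R * R) := `|g p.1 - g p.2| <= e + C * (cos p.1 - cos p.2) ^+ 2.
have cA : compact (A `*` A) by apply: compact_setX; exact: segment_compact.
(* Compactness reduces the claim to a neighbourhood of each pair. Near a diagonal pair continuity
   gives [e] alone; off the diagonal [cos] is injective on [[0, pi]], so the cosine gap stays above
   some [m > 0] and a large [C] wins. *)
have : \forall C \near +oo, A `*` A `<=` P C.
  move/compact_near_coveringP/near_covering_withinP : cA; apply.
  move=> -[a b] [/= Aa Ab].
  have N : \forall p \near (a, b), A p.1 -> A p.2 -> 
      `|g p.1 - g p.2| <= e + `|g a - g b|.
    have N1 : \forall p \near (a, b), A p.1 -> `|g a - g p.1| < e / 2.
      exact: (@cvg_fst _ _ (nbhs a) (nbhs b) _ _ (gA _ Aa)).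
    have N2 : \forall p \near (a, b), A p.2 -> `|g b - g p.2| < e / 2.
      exact: (@cvg_snd _ _ (nbhs a) (nbhs b) _ _ (gA _ Ab)).
    apply: filterS2 N1 N2 => p h1 h2 /h1 {}h1 /h2 {}h2.
    have -> : g p.1 - g p.2 = - (g a - g p.1) + (g b - g p.2) + (g a - g b) by ring.
    rewrite (le_trans (ler_normD _ _))// lerD2r (le_trans (ler_normD _ _))// normrN.
    by rewrite ltW// [ltRHS]splitr ltrD.
  have [ab|ab] := eqVneq a b.
    near=> p C => -[/= A1 A2]; rewrite /P.
    rewrite (@le_trans _ _ e)//; last first.
      by rewrite lerDl mulr_ge0 ?sqr_ge0//; near: C; exact: nbhs_pinfty_ge.
    have /(_ A1 A2) : A p.1 -> A p.2 -> `|g p.1 - g p.2| <= e + `|g a - g b|.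
      by near: p; exact: N.
    by rewrite ab subrr normr0 addr0.
  pose m := (cos a - cos b) ^+ 2 / 2.
  have m0 : 0 < m.
    rewrite divr_gt0// exprn_even_gt0//= subr_eq0.
    by apply: contra ab => /eqP/cos_inj; rewrite !inE => ->.
  have N3 : \forall p \near (a, b), m < (cos p.1 - cos p.2) ^+ 2.
    have c : (cos p.1 - cos p.2) ^+ 2 @[p --> (a, b)] --> (cos a - cos b) ^+ 2.
      rewrite [X in _ --> X]expr2; under eq_fun do rewrite expr2.
      have d : cos p.1 - cos p.2 @[p --> (a, b)] --> cos a - cos b.
        apply: cvgB.
          apply: (@cvg_comp _ _ _ fst cos _ (nbhs a)); first exact: cvg_fst.
          exact: continuous_cos.
        apply: (@cvg_comp _ _ _ snd cos _ (nbhs b)); first exact: cvg_snd.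
        exact: continuous_cos.
      exact: cvgM.
    have h : m < (cos a - cos b) ^+ 2.
      by rewrite /m ltr_pdivrMr// ltr_pMr ?ltr1n// -(@pmulr_lgt0 _ 2^-1)//.
    by move/cvgr_gt : c; apply.
  near=> p C => -[/= A1 A2]; rewrite /P.
  rewrite (@le_trans _ _ (e + `|g a - g b|))//.
    have /(_ A1 A2)// : A p.1 -> A p.2 -> `|g p.1 - g p.2| <= e + `|g a - g b|.
    by near: p; exact: N.
  have C0 : 0 <= C by near: C; exact: nbhs_pinfty_ge.
  rewrite lerD2l (@le_trans _ _ (C * m))//.
    rewrite -ler_pdivrMr//; near: C; exact: nbhs_pinfty_ge.
  rewrite ler_wpM2l// ltW//; near: p; exact: N3.
move=> H; near (+oo : set_system R) => C; exists C.
  by near: C; exact: nbhs_pinfty_ge.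
move=> a b ha hb; have : A `*` A `<=` P C by near: C.
by move=> /(_ (a, b)); apply; split; rewrite /A/= in_itv.
Unshelve. all: by end_near. Qed.

(** [sin th] times a polynomial in [cos th] is a sine polynomial, so it suffices to approximate [g]
    by [sin * h] with [h] continuous, and then [h] by Bernstein polynomials in the variable (1 - cos
    th) / 2. *)
Theorem sine_poly_dense (R : realType) (g : R -> R) (e : R) :
  {within `[0, pi], continuous g} -> g 0 = 0 -> g pi = 0 -> 0 < e ->
  exists2 P, is_sine_poly P & forall th : R, 0 <= th <= pi -> `|g th - P th| <= e.
Proof.
move=> gc g0 gpi e0; have e4 : 0 < e / 4 by rewrite divr_gt0.
have [C C0 gC] := modulus_cos gc e4.
(* [th] is compared with both endpoints, where [g] vanishes. The product of (cos th - 1)^2 and (cos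
   th + 1)^2 is sin^4 th, and the factor of the farther endpoint is at least 1. *)
have gs (th : R) : 0 <= th <= pi -> `|g th| <= e / 4 + C * sin th ^+ 4.
  move=> thpi.
  have h0 : `|g th| <= e / 4 + C * (cos th - 1) ^+ 2.
    by have := gC th 0 thpi; rewrite g0 cos0 subr0; apply; rewrite lexx pi_ge0.
  have h1 : `|g th| <= e / 4 + C * (cos th + 1) ^+ 2.
    have := gC th pi thpi; rewrite gpi cospi subr0 opprK; apply.
    by rewrite lexx pi_ge0.
  have -> : sin th ^+ 4 = (cos th - 1) ^+ 2 * (cos th + 1) ^+ 2.
    by rewrite -[4%N]/(2 * 2)%N exprM sin2cos2; ring.
  have [c0|c0] := leP 0 (cos th).
    apply: (le_trans h0); rewrite lerD2l ler_wpM2l// ler_peMr ?sqr_ge0//.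
    by rewrite exprn_ege1// lerDr.
  apply: (le_trans h1); rewrite lerD2l ler_wpM2l// ler_peMl ?sqr_ge0//.
  by rewrite -sqrrN exprn_ege1// opprB lerBrDr gerDl ltW.
(* Chosen so that C d <= e/4: replacing [g] by [sin * h] costs g d / (sin^2 + d), to which the
   second term of [gs] contributes C d sin^4 / (sin^2 + d). *)
pose d := e / 4 / (C + 1).
have d0 : 0 < d by rewrite divr_gt0// ltr_wpDl.
have sd0 (th : R) : 0 < sin th ^+ 2 + d by rewrite ltr_wpDl// sqr_ge0.
(* [sin * h] is close to [g], and [h], unlike [g / sin], is continuous at the
   endpoints. *)
pose h (th : R) := g th * (sin th / (sin th ^+ 2 + d)).
have hc : {within `[0, pi], continuous h}.
  move=> th; apply: cvgM; first exact: gc.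
  have c : continuous (fun th : R => sin th / (sin th ^+ 2 + d)).
    move=> x; apply: cvgM; first exact: continuous_sin.
    apply: cvgV; first by rewrite gt_eqF.
    apply: cvgD; last exact: cvg_cst.
    by under eq_fun do rewrite expr2; apply: cvgM; exact: continuous_sin.
  exact: (continuous_subspaceT c).
have [C' C'0 hC'] := modulus_cos hc e4.
(* The variance term will be 4 C' x (1 - x) / (n + 1) <= C' / (n + 1), which this [n] brings below
   e/4. *)
have [n Cn] : exists n : nat, C' <= e / 4 * n.+1%:R.
  exists (Num.truncn (C' / (e / 4))); rewrite -ler_pdivrMl// mulrC ltW//.
  by rewrite truncnS_gt.
(* The angle at which (1 - cos th) / 2 equals the Bernstein node k / (n + 1). *)
pose f k := h (acos (1 - 2 * k%:R / n.+1%:R)).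
exists (fun th => sin th * bernstein n.+1 f ((1 - cos th) / 2)).
  exact: is_sine_poly_bernstein.
move=> th thpi.
set x := (1 - cos th) / 2.
have x01 : 0 <= x <= 1.
  by rewrite /x; have := cos_geN1 th; have := cos_le1 th; lra.
have n0 : n.+1%:R != 0 :> R by [].
have B : `|h th - bernstein n.+1 f x| <= e / 2.
  pose C2 := 4 * C' / n.+1%:R ^+ 2.
  apply: le_trans (bernstein_dist
    (g := fun k => e / 4 + C2 * (k%:R - n.+1%:R * x) ^+ 2) x01 _) _.
    move=> k kn.
    have k01 : -1 <= (1 - 2 * k%:R / n.+1%:R : R) <= 1.
      have : 0 <= (k%:R / n.+1%:R : R) <= 1.
        by rewrite divr_ge0//= ler_pdivrMr// mul1r ler_nat.
      by rewrite -mulrA; move: (k%:R / n.+1%:R) => a; lra.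
    have -> : C2 * (k%:R - n.+1%:R * x) ^+ 2 =
        C' * (cos th - (1 - 2 * k%:R / n.+1%:R)) ^+ 2.
      by rewrite /C2 /x; field.
    rewrite -(@acosK _ (1 - 2 * k%:R / n.+1%:R)) ?in_itv//.
    by apply: hC' => //; rewrite acos_ge0// acos_lepi.
  rewrite bernstein_variance subrr expr0n/= addr0.
  have -> : e / 2 = e / 4 + e / 4 by field.
  rewrite lerD2l.
  have -> : C2 * (n.+1%:R * x * (1 - x)) = C' * (4 * (x * (1 - x))) / n.+1%:R.
    by rewrite /C2; field.
  rewrite ler_pdivrMr// (le_trans _ Cn)// ler_piMr//.
  by have := sqr_ge0 (2 * x - 1); lra.
have D : `|g th - sin th * h th| <= e / 2.
  have -> : g th - sin th * h th = g th * (d / (sin th ^+ 2 + d)).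
    by rewrite /h; field; rewrite gt_eqF.
  have q0 : 0 <= d / (sin th ^+ 2 + d) by rewrite divr_ge0 ?ltW.
  rewrite normrM (ger0_norm q0) (le_trans (ler_wpM2r q0 (gs _ thpi)))//.
  rewrite mulrA ler_pdivrMr//.
  have s1 : 0 <= sin th ^+ 2 <= 1.
    by rewrite sqr_ge0 sin2cos2 gerBl sqr_ge0.
  have -> : sin th ^+ 4 = sin th ^+ 2 * sin th ^+ 2 by ring.
  have Cd : C * d <= e / 4.
    have -> : C * d = e / 4 * (C / (C + 1)) by rewrite /d; ring.
    by rewrite ler_piMr ?(ltW e4)// ler_pdivrMr ?ltr_wpDl// mul1r lerDl.
  have := sd0 th; move: (sin th ^+ 2) s1 => s /andP[s0 s1] sd.
  have h1 : C * d * (s * s) <= e / 4 * (s * 1).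
    by apply: ler_pM => //;
      [rewrite mulr_ge0// ltW|rewrite mulr_ge0|rewrite ler_wpM2l].
  have h2 : 0 <= e / 4 * s by rewrite mulr_ge0// ltW.
  have h3 : 0 <= e / 4 * d by rewrite mulr_ge0// ltW.
  lra.
have -> : g th - sin th * bernstein n.+1 f x =
  (g th - sin th * h th) + sin th * (h th - bernstein n.+1 f x) by ring.
rewrite (le_trans (ler_normD _ _))// [leRHS]splitr lerD//.
by rewrite normrM (le_trans _ B)// ler_piMl// sin_max.
Qed.

(** * The maximum principle for the heat equation *)

Section maximum_principle.
Context {R : realType}.

Lemma is_derive_near (f : R -> R) (x d e : R) : is_derive x 1 f d -> 0 < e ->
  exists2 r, 0 < r &
    forall h, h != 0 -> `|h| < r -> `|h^-1 * (f (x + h) - f x) - d| < e.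
Proof.
move=> [df fd] e0.
have : h^-1 *: (f (h *: 1 + x) - f x) @[h --> 0^'] --> d by rewrite -fd; exact: df.
move=> /cvgrPdist_lt/(_ _ e0); rewrite near_withinE => -[r /= r0 H].
exists r => // h h0 hr; have := H h; rewrite /= sub0r normrN => /(_ hr h0).
by rewrite distrC /GRing.scale/= mulr1 [h + x]addrC.
Qed.

(** Only earlier points are compared because the maximum over the closed cylinder may be attained at
    the final time. *)
Lemma is_derive_max_left (f : R -> R) (a x d : R) : a < x ->
  (forall y : R, a < y < x -> f y <= f x) -> is_derive x 1 f d -> 0 <= d.
Proof.
move=> ax fx fd; rewrite leNgt; apply/negP => d0.
have nd0 : 0 < - d by rewrite oppr_gt0.
have [r r0 H] := is_derive_near fd nd0.
pose m := Num.min (r / 2) ((x - a) / 2).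
have m0 : 0 < m by rewrite lt_min !divr_gt0// subr_gt0.
have mr : m < r.
  rewrite (@le_lt_trans _ _ (r / 2)) ?ge_min ?lexx//; lra.
have ma : m < x - a.
  rewrite (@le_lt_trans _ _ ((x - a) / 2)) ?ge_min ?lexx ?orbT//; lra.
have := H (- m); rewrite oppr_eq0 gt_eqF// normrN gtr0_norm// => /(_ isT mr).
apply/negP; rewrite -leNgt (le_trans _ (ler_norm _))// lerDr.
rewrite mulr_le0// ?invr_le0 ?oppr_le0 ?(ltW m0)// subr_le0; apply: fx.
lra.
Qed.

(** [f1] vanishes at the maximum, so [0 < q] would make [f1] positive just to the right of [x], and
    the mean value theorem would give a larger value of [f] there. *)
Lemma is_derive_max_snd (f f1 : R -> R) (a b x q : R) : a < x < b ->
  (forall y : R, a < y < b -> is_derive y 1 f (f1 y)) -> is_derive x 1 f1 q ->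
  (forall y : R, a < y < b -> f y <= f x) -> q <= 0.
Proof.
move=> axb ff1 f1q fx; have /andP[ax xb] := axb.
have f1x0 : f1 x = 0.
  have D : is_derive x 1 f 0.
    apply: (@derive1_at_max _ f a b) => [|y|//|y]; first exact/ltW/(lt_trans ax).
    - by rewrite in_itv/= => yab; have [] := ff1 _ yab.
    - by rewrite in_itv/= => /fx.
  by have [_ <-] := ff1 _ axb; have [_ ->] := D.
rewrite leNgt; apply/negP => q0.
have [r r0 H] := is_derive_near f1q q0.
pose m := Num.min (r / 2) ((b - x) / 2).
have m0 : 0 < m by rewrite lt_min !divr_gt0// subr_gt0.
have mr : m < r.
  rewrite (@le_lt_trans _ _ (r / 2)) ?ge_min ?lexx//; lra.
have mb : m < b - x.
  rewrite (@le_lt_trans _ _ ((b - x) / 2)) ?ge_min ?lexx ?orbT//; lra.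
have xm : x < x + m by rewrite ltrDl.
have [||c + E] := @MVT _ f f1 x (x + m) xm.
- by move=> y; rewrite in_itv/= => /andP[y1 y2]; apply: ff1; lra.
- apply: derivable_within_continuous => y; rewrite in_itv/= => /andP[y1 y2].
  by have [] : is_derive y 1 f (f1 y) by apply: ff1; lra.
rewrite in_itv/= => /andP[xc cm].
have : f (x + m) <= f x by apply: fx; lra.
rewrite -subr_le0 E addrAC subrr add0r pmulr_lle0//; apply/negP; rewrite -ltNge.
have cx0 : 0 < c - x by rewrite subr_gt0.
have := H (c - x); rewrite gt_eqF// gtr0_norm// addrCA subrr addr0 f1x0 subr0.
move=> /(_ isT); have cr : c - x < r by lra.
move=> /(_ cr); rewrite ltr_norml => /andP[+ _].
by rewrite ltrBrDr addNr pmulr_rgt0// invr_gt0.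
Qed.

Theorem heat_maximum_principle (L T e : R) (z z1 z2 : R -> R -> R) :
  0 < L -> 0 <= T ->
  {within `[0, L] `*` `[0, T], continuous (fun p : R * R => z p.1 p.2)} ->
  (forall x t : R, 0 < x < L -> 0 < t ->
    [/\ is_derive x 1 (z ^~ t) (z1 x t), is_derive x 1 (z1 ^~ t) (z2 x t) &
        is_derive t 1 (z x) (z2 x t)]) ->
  (forall x : R, 0 <= x <= L -> z x 0 <= e) ->
  (forall t : R, 0 <= t -> z 0 t <= e) -> (forall t : R, 0 <= t -> z L t <= e) ->
  forall x : R, 0 <= x <= L -> z x T <= e.
Proof.
move=> L0 T0 zc heat ze0 zeL zeR x1 x1L; rewrite leNgt; apply/negP => ez.
(* Subtracting [d * t] makes the inequalities at an interior maximum strict. *)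
pose d := (z x1 T - e) / (T + 1).
have d0 : 0 < d by rewrite divr_gt0 ?subr_gt0// ltr_wpDl.
set K : set (R * R) := `[0, L] `*` `[0, T].
have cK : compact K by apply: compact_setX; exact: segment_compact.
have x1K : K (x1, T) by split; rewrite /= in_itv/= ?lexx ?T0.
pose f (p : R * R) := z p.1 p.2 - d * p.2.
have fc : {within K, continuous f}.
  move=> p; apply: cvgB; first exact: zc.
  have c : continuous (fun p : R * R => d * p.2).
    by move=> q; apply: cvgM; [exact: cvg_cst|exact: cvg_snd].
  exact: (continuous_subspaceT c).
have [[xs ts] + fmax] := compact_EVT_max (ex_intro _ _ x1K) cK fc.
rewrite inE => -[/=]; rewrite !in_itv/= => /andP[xs0 xsL] /andP[ts0 tsT].
have {}fmax x t : 0 <= x <= L -> 0 <= t <= T -> z x t - d * t <= z xs ts - d * ts.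
  move=> hx ht; apply: (fmax (x, t)).
  by rewrite inE; split; rewrite /= in_itv.
(* By the choice of [d], [z x1 T - d * T] equals [e + d]; the [T + 1] in its denominator also covers
   [T = 0]. *)
have ef : e < z xs ts - d * ts.
  apply: (@lt_le_trans _ _ (z x1 T - d * T)); last first.
    by apply: fmax; rewrite ?lexx ?T0.
  have E : z x1 T - e = d * (T + 1) by rewrite /d divfK// gt_eqF// ltr_wpDl.
  lra.
have dts : 0 <= d * ts by rewrite mulr_ge0// ltW.
have xsP : 0 < xs < L.
  rewrite !lt_neqAle xs0 xsL !andbT; apply/andP; split; apply/eqP => xsE.
    by have := zeL ts ts0; rewrite xsE; lra.
  by have := zeR ts ts0; rewrite -xsE; lra.
have tsP : 0 < ts.
  rewrite lt_neqAle ts0 andbT; apply/eqP => tsE.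
  by have := ze0 xs; rewrite xs0 xsL tsE => /(_ isT); lra.
have [zx zxx zt] := heat _ _ xsP tsP.
have q0 : z2 xs ts <= 0.
  apply: (@is_derive_max_snd (z ^~ ts) (z1 ^~ ts) 0 L xs) => // y yL.
    by have [] := heat _ _ yL tsP.
  have := fmax y ts; rewrite ts0 tsT => /(_ _ isT).
  by rewrite lerD2r; apply; move: yL => /andP[/ltW -> /ltW ->].
have : 0 <= z2 xs ts - d.
  apply: (@is_derive_max_left (fun t => z xs t - d * t) 0 ts) => //.
    move=> y /andP[y0 yts]; apply: fmax; first by rewrite xs0.
    by rewrite (ltW y0) (le_trans (ltW yts)).
  have dd : is_derive ts 1 (fun t : R => d * t) d.
    by apply: is_derive_eq; rewrite /GRing.scale/= mulr1.
  exact: is_deriveB.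
lra.
Qed.

End maximum_principle.

(** * Heat solutions on an interval and their sine series *)

Section heat_solution.
Context {R : realType}.
Implicit Types (L x t : R) (z : R -> R -> R).

Lemma is_derive_mull (c x : R) : is_derive x 1 (fun y : R => c * y) c.
Proof. by apply: is_derive_eq; rewrite /GRing.scale/= mulr1. Qed.

(** The shared [z2], both second space derivative and time derivative, encodes the equation;
    derivatives given as witnesses combine directly under sums and differences. *)
Definition heat_solution L z : Prop :=
  {within `[0, L] `*` `[0, +oo[, continuous (fun p : R * R => z p.1 p.2)} /\
  exists z1 z2 : R -> R -> R, forall x t, 0 < x < L -> 0 < t ->
    [/\ is_derive x 1 (z ^~ t) (z1 x t), is_derive x 1 (z1 ^~ t) (z2 x t) &
        is_derive t 1 (z x) (z2 x t)].

Lemma heat_solutionB L z z' : heat_solution L z -> heat_solution L z' ->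
  heat_solution L (fun x t => z x t - z' x t).
Proof.
move=> [zc [z1 [z2 zh]]] [z'c [z1' [z2' zh']]]; split.
  by move=> p; apply: cvgB; [exact: zc|exact: z'c].
exists (fun x t => z1 x t - z1' x t), (fun x t => z2 x t - z2' x t) => x t xL t0.
have [h1 h2 h3] := zh x t xL t0; have [h1' h2' h3'] := zh' x t xL t0.
by split; exact: is_deriveB.
Qed.

Lemma heat_solution_affine L (a b : R) : heat_solution L (fun x _ => a + b * x).
Proof.
split.
  have c : continuous (fun p : R * R => a + b * p.1).
    move=> q; apply: cvgD; first exact: cvg_cst.
    by apply: cvgM; [exact: cvg_cst|exact: cvg_fst].
  exact: (continuous_subspaceT c).
exists (fun _ _ => b), (fun _ _ => 0) => x t _ _; split; last 2 first.
- exact: is_derive_cst.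
- exact: is_derive_cst.
by have := is_deriveD (is_derive_cst a x 1) (is_derive_mull b x); rewrite add0r.
Qed.

Lemma heat_solution_le L T (e : R) z : 0 < L -> 0 <= T -> heat_solution L z ->
  (forall x, 0 <= x <= L -> z x 0 <= e) ->
  (forall t, 0 <= t -> z 0 t <= e) -> (forall t, 0 <= t -> z L t <= e) ->
  forall x, 0 <= x <= L -> z x T <= e.
Proof.
move=> L0 T0 [zc [z1 [z2 zh]]].
apply: (@heat_maximum_principle _ L T e z z1 z2) => //.
apply: continuous_subspaceW zc => -[x t] [/= hx]; rewrite !in_itv/= => /andP[t0 _].
by split; rewrite /= ?in_itv/= ?t0.
Qed.

Lemma heat_solution_norm_le L T (e : R) z : 0 < L -> 0 <= T ->
  heat_solution L z ->
  (forall x, 0 <= x <= L -> `|z x 0| <= e) ->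
  (forall t, 0 <= t -> z 0 t = 0) -> (forall t, 0 <= t -> z L t = 0) ->
  forall x, 0 <= x <= L -> `|z x T| <= e.
Proof.
move=> L0 T0 zh ze z0 zL x xL.
have e0 : 0 <= e by rewrite (le_trans _ (ze 0 _))// lexx ltW.
have Nzh := heat_solutionB (heat_solution_affine L 0 0) zh.
rewrite ler_norml; apply/andP; split.
  rewrite lerNl; have -> : - z x T = 0 + 0 * x - z x T by ring.
  apply: (@heat_solution_le L T e _ L0 T0 Nzh) => //.
  - by move=> y /ze; rewrite ler_norml mul0r addr0 sub0r lerNl => /andP[].
  - by move=> t t0; rewrite z0// mul0r addr0 subr0.
  - by move=> t t0; rewrite zL// mul0r addr0 subr0.
apply: (@heat_solution_le L T e _ L0 T0 zh) => //.
- by move=> y /ze; rewrite ler_norml => /andP[].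
- by move=> t /z0 ->.
- by move=> t /zL ->.
Qed.

Lemma is_derive_sum_fun N (f : 'I_N -> R -> R) (df : 'I_N -> R) x :
  (forall n, is_derive x 1 (f n) (df n)) ->
  is_derive x 1 (fun y => \sum_(n < N) f n y) (\sum_(n < N) df n).
Proof. by move=> fdf; rewrite -fct_sumE; exact: is_derive_sum. Qed.

Lemma is_derive_sin_mull (c x : R) :
  is_derive x 1 (fun y => sin (c * y)) (c * cos (c * x)).
Proof.
rewrite mulrC; apply: (is_derive1_comp (f := sin)).
exact: is_derive_mull.
Qed.

Lemma is_derive_cos_mull (c x : R) :
  is_derive x 1 (fun y => cos (c * y)) (- (c * sin (c * x))).
Proof.
rewrite mulrC -mulNr; apply: (is_derive1_comp (f := cos)).
exact: is_derive_mull.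
Qed.

Lemma is_derive_expR_mull (c x : R) :
  is_derive x 1 (fun y => expR (c * y)) (c * expR (c * x)).
Proof.
rewrite mulrC; apply: (is_derive1_comp (f := expR)).
exact: is_derive_mull.
Qed.

Lemma is_derive_cstM (f : R -> R) (x df c : R) : is_derive x 1 f df ->
  is_derive x 1 (fun y => c * f y) (c * df).
Proof. exact: is_deriveZ. Qed.

Lemma heat_solution_sine_sum L (k : R) (p : nat -> R) N :
  heat_solution L (fun x t =>
    \sum_(n < N) p n * expR (- (n%:R ^+ 2 * (k ^+ 2 * t))) * sin (n%:R * k * x)).
Proof.
have eE n t : expR (- (n%:R ^+ 2 * (k ^+ 2 * t))) = expR (- (n%:R * k) ^+ 2 * t).
  by congr expR; ring.
split.
  have c : continuous (fun q : R * R => \sum_(n < N)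
      p n * expR (- (n%:R ^+ 2 * (k ^+ 2 * q.2))) * sin (n%:R * k * q.1)).
    elim: N => [|N IH].
      by under eq_fun do rewrite big_ord0; exact: cst_continuous.
    under eq_fun do rewrite big_ord_recr/=.
    move=> q; apply: cvgD; first exact: IH.
    apply: cvgM; last first.
      apply: (@continuous_comp _ _ _ (fun q : R * R => N%:R * k * q.1) sin);
        last exact: continuous_sin.
      by apply: cvgM; [exact: cvg_cst|exact: cvg_fst].
    apply: cvgM; first exact: cvg_cst.
    apply: (@continuous_comp _ _ _
      (fun q : R * R => - (N%:R ^+ 2 * (k ^+ 2 * q.2))) expR);
      last exact: continuous_expR.
    apply: cvgN; apply: cvgM; first exact: cvg_cst.
    by apply: cvgM; [exact: cvg_cst|exact: cvg_snd].
  exact: (continuous_subspaceT c).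
exists (fun x t => \sum_(n < N) p n * expR (- (n%:R ^+ 2 * (k ^+ 2 * t))) *
  (n%:R * k * cos (n%:R * k * x))).
exists (fun x t => \sum_(n < N) p n * expR (- (n%:R ^+ 2 * (k ^+ 2 * t))) *
  (n%:R * k * - (n%:R * k * sin (n%:R * k * x)))).
move=> x t _ _; split.
- apply: is_derive_sum_fun => n; apply: is_derive_cstM; exact: is_derive_sin_mull.
- apply: is_derive_sum_fun => n; do 2 apply: is_derive_cstM.
  exact: is_derive_cos_mull.
- apply: is_derive_sum_fun => n.
  have -> : (fun s =>
      p n * expR (- (n%:R ^+ 2 * (k ^+ 2 * s))) * sin (n%:R * k * x)) =
      (fun s => p n * sin (n%:R * k * x) * expR (- (n%:R * k) ^+ 2 * s)).
    by apply/funext => s; rewrite eE mulrAC.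
  have h := is_derive_cstM (p n * sin (n%:R * k * x))
    (is_derive_expR_mull (- (n%:R * k) ^+ 2) t).
  by apply: (is_derive_eq h); rewrite eE; ring.
Qed.

Lemma sine_series_bound (b : nat -> R) (B s : R) :
  4 <= s -> (forall n, (0 < n)%N -> `|b n| <= B) ->
  forall n, `|b n * expR (- (n%:R ^+ 2 * s))| * n%:R ^+ 2 <=
            (2 * B * expR (- s)) * 2^-1 ^+ n.
Proof.
move=> s4 bB n; have B0 : 0 <= B by rewrite (le_trans _ (bB 1%N _)).
(* [b 0] is not controlled by [bB]; the weight 0^2 removes it. *)
case: n => [|n].
  rewrite [0%:R ^+ 2]expr0n/= mulr0 expr0 mulr1.
  by apply: mulr_ge0; [exact: mulr_ge0|exact: expR_ge0].
rewrite normrM (ger0_norm (expR_ge0 _)) -[leLHS]mulrA.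
have -> : 2 * B * expR (- s) * 2^-1 ^+ n.+1 =
  B * (2 * expR (- s) * 2^-1 ^+ n.+1) by ring.
apply: ler_pM => //; first exact: bB.
by rewrite mulrC sqr_expR_le.
Qed.

Lemma sine_seriesB (k A A' : R) (a a' : nat -> R) x :
  (forall n, `|a n| * n%:R ^+ 2 <= A * 2^-1 ^+ n) ->
  (forall n, `|a' n| * n%:R ^+ 2 <= A' * 2^-1 ^+ n) ->
  sine_series k a x - sine_series k a' x =
  sine_series k (fun n => a n - a' n) x.
Proof.
move=> aA aA'; have c := is_cvg_series_geometric_bound (sine_series_term k aA x).
have c' := is_cvg_series_geometric_bound (sine_series_term k aA' x).
rewrite /sine_series -lim_seriesB//; congr (limn (series _)).
by apply/funext => n; rewrite !fctE mulrBl.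
Qed.

Lemma sine_sum_series (k : R) (p : nat -> R) N x :
  (forall n, (N <= n)%N -> p n = 0) ->
  \sum_(n < N) p n * sin (n%:R * k * x) = sine_series k p x.
Proof.
move=> p0; apply/esym/lim_near_cst; first exact: Rhausdorff.
exists N => // M /= NM; rewrite /series/= big_mkord.
have E K : \sum_(n < K) p n * sin (n%:R * k * x) =
    \sum_(n < K) p n * sin (n%:R * (k * x)).
  by apply: eq_bigr => i _; rewrite mulrA.
by rewrite !E -(sine_poly_widen _ p0 NM).
Qed.

Lemma sin_natr_pi n : sin (n%:R * pi) = 0 :> R.
Proof.
elim: n => [|n IH]; first by rewrite mul0r sin0.
by rewrite -[n.+1]addn1 natrD mulrDl mul1r sinD sinpi IH mulr0 mul0r addr0.
Qed.

End heat_solution.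

(** Bounded coefficients and [4 <= (pi / L) ^+ 2 * t] are what [sine_series_bound] requires, so
    value and derivative of the series both inherit the factor e^{-(pi / L)^2 t}. *)
Theorem heat_solution_sine_series (R : realType) (L : R) (v : R -> R -> R) :
  0 < L -> heat_solution L v ->
  (forall t, 0 <= t -> v 0 t = 0) -> (forall t, 0 <= t -> v L t = 0) ->
  exists (b : nat -> R) (B : R), (forall n, (0 < n)%N -> `|b n| <= B) /\
    forall x t, 0 <= x <= L -> 4 <= (pi / L) ^+ 2 * t ->
      v x t = sine_series (pi / L)
        (fun n => b n * expR (- (n%:R ^+ 2 * ((pi / L) ^+ 2 * t)))) x.
Proof.
move=> L0 vh v0 vL; set k := pi / L.
have k0 : 0 < k by rewrite divr_gt0// pi_gt0.
have kN0 : k != 0 by rewrite gt_eqF.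
have kL : pi / k = L by rewrite /k invf_div mulrC divfK// gt_eqF// pi_gt0.
have thL th : 0 <= th <= pi -> 0 <= th / k <= L.
  move=> /andP[th0 thpi]; rewrite divr_ge0 ?(ltW k0)//= -kL.
  by rewrite ler_wpM2r// invr_ge0 ltW.
pose g th := v (th / k) 0.
have gc : {within `[0, pi], continuous g}.
  apply/subspace_continuousP => th; rewrite /= in_itv/= => /thL thkL.
  apply/cvgrPdist_lt => e e0.
  have [/subspace_continuousP vc _] := vh.
  have K0 x : 0 <= x <= L -> (`[0, L] `*` `[0, +oo[)%classic (x, 0 : R).
    by move=> xL; split; rewrite /= in_itv/= ?xL ?lexx.
  have /cvgrPdist_lt/(_ _ e0) vn := vc _ (K0 _ thkL).
  have c : continuous (fun th : R => (th / k, 0 : R)).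
    move=> x; apply: (@cvg_pair _ _ _ _ (nbhs (x / k)) (nbhs (0 : R)));
      last exact: cvg_cst.
    by apply: cvgM; [exact: cvg_id|exact: cvg_cst].
  rewrite near_withinE in vn; rewrite near_withinE.
  have : nbhs th ((fun th : R => (th / k, 0 : R)) @^-1` _) := c th _ vn.
  apply: filterS => y /= h yp; apply: h.
  by apply/K0/thL; move: yp; rewrite in_itv.
have g0 : g 0 = 0 by rewrite /g mul0r v0.
have gpi : g pi = 0 by rewrite /g kL vL.
pose e (j : nat) : R := j.+1%:R^-1.
have e0 j : 0 < e j by rewrite invr_gt0.
have ej (j l : nat) : (j <= l)%N -> e l <= e j.
  by move=> jl; rewrite lef_pV2 ?posrE// ler_nat.
have /choice[P HP] (j : nat) : exists Np : nat * (nat -> R),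
    (forall n, (Np.1 <= n)%N -> Np.2 n = 0) /\
    forall th, 0 <= th <= pi ->
      `|g th - \sum_(n < Np.1) Np.2 n * sin (n%:R * th)| <= e j.
  have [f [N [p [p0 fp]]] gf] := sine_poly_dense gc g0 gpi (e0 j).
  by exists (N, p); split=> //= th /gf; rewrite fp.
pose p j := (P j).2; pose N j := (P j).1.
have p0 j n : (N j <= n)%N -> p j n = 0 by have [+ _] := HP j; apply.
have gp j th : 0 <= th <= pi ->
    `|g th - \sum_(n < N j) p j n * sin (n%:R * th)| <= e j.
  by have [_] := HP j; apply.
have pp j l n : (0 < n)%N -> `|p j n - p l n| <= 2 * (e j + e l).
  (* [M] also exceeds [n], so that [sine_coef_le] applies to index [n] even if both polynomials are
     shorter. *)
  move=> n0; pose M := maxn (maxn (N j) (N l)) n.+1.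
  have jM : (N j <= M)%N by rewrite /M !leq_max leqnn.
  have lM : (N l <= M)%N by rewrite /M !leq_max leqnn orbT.
  have nM : (0 < n < M)%N by rewrite n0 /M leq_max leqnn orbT.
  apply: (sine_coef_le (p := fun n => p j n - p l n) _ nM) => th thpi.
  under eq_bigr do rewrite mulrBl.
  rewrite sumrB -(sine_poly_widen _ (@p0 j) jM) -(sine_poly_widen _ (@p0 l) lM).
  by rewrite (le_trans (ler_distD (g th) _ _))// lerD ?gp// distrC gp.
pose b n : R := limn (fun j => p j n).
have cb n : (0 < n)%N -> cvgn (fun j => p j n).
  move=> n0; apply: cauchy_cvg; apply: cauchy_exP => d d0.
  have d4 : 0 < d / 4 by rewrite divr_gt0.
  have [j _ /(_ j (leqnn _)) ejd] := near_infty_natSinv_lt (PosNum d4).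
  exists (p j n); exists j => // l /= jl; rewrite /ball/=.
  rewrite (le_lt_trans (pp _ _ _ n0))//.
  have := ej _ _ jl; rewrite /= -/(e j) in ejd; lra.
have bp j n : (0 < n)%N -> `|b n - p j n| <= 4 * e j.
  move=> n0.
  have c : `|p l n - p j n| @[l --> \oo] --> `|b n - p j n|.
    by apply: cvg_norm; apply: cvgB; [exact: cb|exact: cvg_cst].
  rewrite -(cvg_lim (@Rhausdorff R) c); apply: limr_le.
    by apply/cvg_ex; eexists; exact: c.
  exists j => // l /= jl; rewrite (le_trans (pp _ _ _ n0))//.
  by have := ej _ _ jl; lra.
pose B := \sum_(n < N 0%N) `|p 0%N n| + 4 * e 0%N.
have bB n : (0 < n)%N -> `|b n| <= B.
  move=> n0; rewrite -[b n](subrK (p 0%N n)) addrC.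
  rewrite (le_trans (ler_normD _ _))// lerD ?bp//.
  have [Nn|nN] := leqP (N 0%N) n; first by rewrite p0// normr0 sumr_ge0.
  by rewrite (bigD1 (Ordinal nN))//= lerDl sumr_ge0.
exists b, B; split=> // x t xL t4.
set s := k ^+ 2 * t in t4 *.
have t0 : 0 <= t.
  have : 0 <= k ^+ 2 * t by rewrite (le_trans _ t4).
  by rewrite pmulr_rge0// exprn_gt0.
pose ex n := expR (- (n%:R ^+ 2 * s)) : R.
(* 17 = 1 + 16: the maximum principle contributes [e j]; replacing [p j] by [b] changes coefficients
   by at most [4 * e j], and [sine_series_bound] and [sine_series_le] each double this. *)
have bnd j : `|v x t - sine_series k (fun n => b n * ex n) x| <= 17 * e j.
  have vP : `|v x t - sine_series k (fun n => p j n * ex n) x| <= e j.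
    rewrite -(@sine_sum_series _ _ _ (N j)); last by move=> n /p0 ->; rewrite mul0r.
    apply: (heat_solution_norm_le L0 t0
      (heat_solutionB vh (heat_solution_sine_sum L k (p j) (N j)))) => //.
    - move=> y yL; have ykpi : 0 <= k * y <= pi.
        move: yL => /andP[y0 yL]; rewrite mulr_ge0 ?(ltW k0)//=.
        by rewrite -ler_pdivlMl// mulrC kL.
      have := gp j (k * y) ykpi; rewrite /g [k * y]mulrC mulfK//.
      congr (`|_ - _| <= _); apply: eq_bigr => n _.
      by rewrite !mulr0 oppr0 expR0 mulr1 -mulrA [y * k]mulrC.
    - move=> r /v0 ->; rewrite big1 ?subr0// => n _.
      by rewrite mulr0 sin0 mulr0.
    - move=> r /vL ->; rewrite big1 ?subr0// => n _.
      have -> : n%:R * k * L = n%:R * pi by rewrite -mulrA /k divfK// gt_eqF.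
      by rewrite sin_natr_pi mulr0.
  have pB n : (0 < n)%N -> `|p j n| <= B + 4 * e j.
    move=> n0; rewrite -[p j n](subrK (b n)) addrC (le_trans (ler_normD _ _))//.
    by rewrite lerD ?bB// distrC bp.
  have pbB n : (0 < n)%N -> `|p j n - b n| <= 4 * e j.
    by move=> n0; rewrite distrC bp.
  have sB : `|sine_series k (fun n => p j n * ex n) x -
             sine_series k (fun n => b n * ex n) x| <= 16 * e j.
    rewrite (sine_seriesB k x (sine_series_bound t4 pB) (sine_series_bound t4 bB)).
    have h n : `|p j n * ex n - b n * ex n| * n%:R ^+ 2 <=
        (2 * (4 * e j) * expR (- s)) * 2^-1 ^+ n.
      by rewrite -mulrBl; exact: (sine_series_bound (b := fun n => p j n - b n)).
    rewrite (le_trans (sine_series_le k h x))//.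
    have es : expR (- s) <= 1 by rewrite expR_le1; lra.
    have := ler_wpM2l (ltW (e0 j)) es; lra.
  have -> : 17 * e j = e j + 16 * e j by ring.
  apply: le_trans (ler_distD (sine_series k (fun n => p j n * ex n) x) _ _) _.
  exact: lerD.
apply/eqP; rewrite -subr_eq0 -normr_le0; apply/ler_addgt0Pl => d d0.
have d17 : 0 < d / 17 by rewrite divr_gt0.
have [j _ /(_ j (leqnn _)) ejd] := near_infty_natSinv_lt (PosNum d17).
rewrite addr0 (le_trans (bnd j))//; rewrite /= -/(e j) in ejd; lra.
Qed.

(** * Exponentially small perturbations of quotients *)

Section exponential_rate.
Context {R : realType}.
Implicit Types (k K : R) (A : set R).

Lemma near_expR_small K k (e : R) : 0 < k -> 0 < e ->
  \forall c \near +oo, K * expR (- (k * c)) <= e.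
Proof.
move=> k0 e0; near=> c.
have h : `|K| / e <= k * c.
  by rewrite -ler_pdivrMl//; near: c; exact: nbhs_pinfty_ge.
rewrite expRN ler_pdivrMr ?expR_gt0// mulrC -ler_pdivrMr//.
rewrite (le_trans _ (expR_ge1Dx _))// (@le_trans _ _ (`|K| / e))//.
- by rewrite ler_wpM2r ?invr_ge0 ?(ltW e0)// ler_norm.
- by rewrite (le_trans h)// lerDr.
Unshelve. all: by end_near. Qed.

Lemma uniform_cvg_expR A (f : R -> R -> R) (u : R -> R) K k : 0 < k ->
  (\forall c \near +oo, forall y, A y -> `|f c y - u y| <= K * expR (- (k * c))) ->
  {uniform A, f @ +oo --> u}.
Proof.
move=> k0 fu P /uniform_nbhs[E [entE EP]].
rewrite -entourage_ballE in entE; have [e /= e0 eE] := entE.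
have e2 : 0 < e / 2 by rewrite divr_gt0.
have : \forall c \near +oo, P (f c); last by [].
apply: filterS2 fu (near_expR_small K k0 e2) => c fuc Kc.
apply: EP => y Ay; apply: eE; rewrite /ball/= distrC.
rewrite (le_lt_trans (fuc _ Ay))// (le_lt_trans Kc)//; lra.
Qed.

(** The difference is (g b - a f) / ((b + f) b); [eta <= m / 2] keeps b + f above m/2, whence the
    factor 2 / m^2. *)
Lemma quotient_perturbation (a b f g m M eta : R) : 0 < m -> m <= b -> b <= M ->
  `|f| <= eta -> `|g| <= eta -> eta <= m / 2 ->
  `|(a + g) / (b + f) - a / b| <= (M + `|a|) * 2 / m ^+ 2 * eta.
Proof.
move=> m0 mb bM feta geta etam.
have eta0 : 0 <= eta by rewrite (le_trans _ feta).
have b0 : 0 < b by rewrite (lt_le_trans m0).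
have bf : m / 2 <= b + f.
  by move: feta; rewrite ler_norml => /andP[? _]; lra.
have bf0 : 0 < b + f by rewrite (lt_le_trans _ bf)// divr_gt0.
have -> : (a + g) / (b + f) - a / b = (g * b - a * f) / ((b + f) * b).
  by field; rewrite !gt_eqF.
rewrite normrM normfV (gtr0_norm (mulr_gt0 bf0 b0)) ler_pdivrMr ?mulr_gt0//.
have h1 : `|g * b - a * f| <= (M + `|a|) * eta.
  rewrite (le_trans (ler_normB _ _))// !normrM (gtr0_norm b0) mulrDl mulrC.
  by rewrite lerD// ler_pM// ltW.
rewrite (le_trans h1)//.
have Ma : 0 <= (M + `|a|) * eta.
  by rewrite mulr_ge0// addr_ge0// (le_trans (ltW b0)).
have h2 : m / 2 * m <= (b + f) * b by rewrite ler_pM// ltW// divr_gt0.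
have -> : (M + `|a|) * 2 / m ^+ 2 * eta * ((b + f) * b) =
  (M + `|a|) * eta * (2 / m ^+ 2 * ((b + f) * b)) by ring.
rewrite ler_peMr//.
have E : 2 / m ^+ 2 * (m / 2 * m) = 1 by field; rewrite gt_eqF.
by rewrite -[leLHS]E ler_wpM2l// divr_ge0// sqr_ge0.
Qed.

Lemma quotient_rate A (F G : R -> R -> R) (a : R) (b : R -> R) m M K k :
  0 < m -> 0 < k -> (forall y, A y -> m <= b y <= M) ->
  (\forall c \near +oo, forall y, A y ->
    `|F c y| <= K * expR (- (k * c)) /\ `|G c y| <= K * expR (- (k * c))) ->
  exists C, \forall c \near +oo, forall y, A y ->
    `|(a + G c y) / (b y + F c y) - a / b y| <= C * expR (- (k * c)).
Proof.
move=> m0 k0 mbM FG; exists ((M + `|a|) * 2 / m ^+ 2 * K).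
have m2 : 0 < m / 2 by rewrite divr_gt0.
apply: filterS2 FG (near_expR_small K k0 m2) => c FGc Kc y Ay.
have [Fc Gc] := FGc y Ay; have /andP[mb bM] := mbM y Ay.
rewrite -mulrA; exact: quotient_perturbation mb bM Fc Gc Kc.
Qed.

End exponential_rate.

(** * Convergence of the rescaled profile *)

Section profile.
Context {R : realType}.
Variable M : R.

(** A convex combination of 1 and e^M stays positive also when M < 0. It serves both limits, with s
    = y and with s = x / L. *)
Lemma profile_denominator (s : R) : 0 <= s <= 1 ->
  Num.min 1 (expR M) <= 1 + (expR M - 1) * s <= 1 + `|expR M - 1|.
Proof.
move=> /andP[s0 s1]; apply/andP; split.
  have -> : 1 + (expR M - 1) * s = 1 * (1 - s) + expR M * s by ring.
  have h1 : Num.min 1 (expR M) <= 1 by rewrite ge_min lexx.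
  have h2 : Num.min 1 (expR M) <= expR M by rewrite ge_min lexx orbT.
  have h3 : Num.min 1 (expR M) * (1 - s) <= 1 * (1 - s).
    by rewrite ler_wpM2r// subr_ge0.
  have h4 : Num.min 1 (expR M) * s <= expR M * s by rewrite ler_wpM2r.
  lra.
by rewrite lerD2l (le_trans (ler_norm _))// normrM ler_piMr// ger0_norm.
Qed.

Lemma min1_expR_gt0 : 0 < Num.min 1 (expR M).
Proof. by rewrite lt_min ltr01 expR_gt0. Qed.

Let a (c : R) (n : nat) : R := n%:R^-1 * expR (- (n%:R ^+ 2 * (pi ^+ 2 * c))).

Lemma phi_sine_series (y c : R) : phi y c = y + 2 / pi * sine_series pi (a c) y.
Proof.
rewrite /phi /sine_series; congr (_ + _ * _).
suff -> : series (fun n => a c n * sin (n%:R * pi * y)) = (fun N => \sum_(1 <= n < N)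
  sin (n%:R * pi * y) / n%:R * expR (- (n%:R ^+ 2 * pi ^+ 2 * c))) by [].
apply/funext => N.
rewrite /series/=; case: N => [|N]; first by rewrite !big_geq.
(* The series of [phi] starts at 1 and [sine_series] at 0; the extra term vanishes because sin 0 =
   0. *)
rewrite [LHS]big_ltn// !mul0r sin0 mulr0 add0r; apply: eq_bigr => n _.
by rewrite /a !mulrA mulrAC [_^-1 * _]mulrC.
Qed.

Lemma pi2c_ge4 (c : R) : 1 <= c -> 4 <= pi ^+ 2 * c.
Proof.
move=> c1; have p2 := pi_ge2 R.
have : 4 * 1 <= pi ^+ 2 * c by rewrite ler_pM//; nra.
by rewrite mulr1.
Qed.

Lemma phi_coef_le (c : R) : 1 <= c ->
  forall n, `|a c n| * n%:R ^+ 2 <=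
    (2 * 1 * expR (- (pi ^+ 2 * c))) * 2^-1 ^+ n.
Proof.
move=> c1; apply: sine_series_bound; first exact: pi2c_ge4.
by move=> n n0; rewrite ger0_norm ?invr_ge0// invf_le1 ?ltr0n// ler1n.
Qed.

Lemma phi_yE (y c : R) : 1 <= c ->
  phi_y y c = 1 + 2 / pi * sine_series' pi (a c) y.
Proof.
move=> c1; rewrite /phi_y derive1E.
have -> : (fun z => phi z c) = (fun z => z + 2 / pi * sine_series pi (a c) z).
  by apply/funext => z; exact: phi_sine_series.
have h := is_derive_cstM (2 / pi) (is_derive_sine_series pi (phi_coef_le c1) y).
by have [_ ->] := is_deriveD (is_derive_id y 1) h.
Qed.

Lemma Phi_rescaled (c y : R) : 0 < c -> (Num.sqrt c)^-1 * Phi M c (y / Num.sqrt c) =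
  (expR M - 1) * phi_y y c / (1 + (expR M - 1) * phi y c).
Proof.
by move=> c0; rewrite /Phi mulKf ?divfK// gt_eqF// sqrtr_gt0.
Qed.

Lemma Phi_rate : exists C, \forall c \near +oo, forall y, `[0, 1]%classic y ->
  `|(Num.sqrt c)^-1 * Phi M c (y / Num.sqrt c) - U M 1 y| <=
    C * expR (- (pi ^+ 2 * c)).
Proof.
set al := expR M - 1.
have pi2 : 0 < 2 / pi :> R by rewrite divr_gt0// pi_gt0.
have pi20 : 0 < pi ^+ 2 :> R by rewrite exprn_gt0// pi_gt0.
pose F (c y : R) := al * (2 / pi) * sine_series pi (a c) y.
pose G (c y : R) := al * (2 / pi) * sine_series' pi (a c) y.
(* The coefficient bound 2 e^{-pi^2 c} gives 4 e^{-pi^2 c} for the series and 4 pi e^{-pi^2 c} for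
   its derivative; the sum of the constants covers both. *)
pose K := `|al * (2 / pi)| * (4 * (1 + pi)) : R.
have [||C HC] := @quotient_rate R `[0, 1]%classic F G al (fun y => 1 + al * y)
  _ (1 + `|al|) K _ min1_expR_gt0 pi20.
- by move=> y; rewrite /= in_itv/=; exact: profile_denominator.
- near=> c => y _; have c1 : 1 <= c by near: c; exact: nbhs_pinfty_ge.
  have p0 := pi_gt0 R; have e0 := expR_gt0 (- (pi ^+ 2 * c)).
  rewrite /F /G !(normrM (al * _)) /K -mulrA.
  split; apply: ler_wpM2l => //.
    rewrite (le_trans (sine_series_le _ (phi_coef_le c1) _))//.
    have := mulr_gt0 e0 p0; lra.
  rewrite (le_trans (sine_series'_le _ (phi_coef_le c1) _))// gtr0_norm//.
  have := mulr_gt0 e0 p0; lra.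
exists C; near=> c => y Ay; have c1 : 1 <= c by near: c; exact: nbhs_pinfty_ge.
rewrite Phi_rescaled ?(lt_le_trans ltr01)// phi_yE// phi_sine_series /U -/al.
have -> : al * (1 + 2 / pi * sine_series' pi (a c) y) = al + G c y.
  by rewrite /G; ring.
have -> : 1 + al * (y + 2 / pi * sine_series pi (a c) y) = 1 + al * y + F c y.
  by rewrite /F; ring.
by move: y Ay; near: c.
Unshelve. all: by end_near. Qed.

End profile.

(** * The Hopf-Cole solution on the interval *)

Section interval_problem.
Context {R : realType}.

(** Properness makes the limit in [derive_itv] unique. Nearby points are taken on the right of [x],
    except at [x = b], where they come from the left. *)
Lemma dnbhs_itv_proper (a b x : R) : a < b -> a <= x <= b ->
  ProperFilter (within `[a, b] x^').
Proof.
move=> ab /andP[ax xb]; apply: Build_ProperFilter_ex => P.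
rewrite /within/= near_withinE => -[r /= r0 rP].
have [xltb|blex] := ltP x b.
  pose d := Num.min (r / 2) (b - x).
  have d0 : 0 < d by rewrite lt_min divr_gt0//= subr_gt0.
  have dr : d < r by rewrite (@le_lt_trans _ _ (r / 2)) ?ge_min ?lexx//; lra.
  have db : d <= b - x by rewrite ge_min lexx orbT.
  exists (x + d); apply: rP.
  - by rewrite /ball/= opprD addNKr normrN gtr0_norm.
  - by rewrite -subr_eq0 addrAC subrr add0r gt_eqF.
  - by rewrite /= in_itv/=; lra.
pose d := Num.min (r / 2) (x - a).
have d0 : 0 < d by rewrite lt_min divr_gt0//= subr_gt0 (lt_le_trans ab).
have dr : d < r by rewrite (@le_lt_trans _ _ (r / 2)) ?ge_min ?lexx//; lra.
have da : d <= x - a by rewrite ge_min lexx orbT.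
exists (x - d); apply: rP.
- by rewrite /ball/= opprB addrC subrK gtr0_norm.
- by rewrite -subr_eq0 addrAC subrr add0r oppr_eq0 gt_eqF.
- by rewrite /= in_itv/=; lra.
Qed.

(** Agreement with [g] is asked on the interval only, while [g] is differentiable in the two-sided
    sense; with [g] a sine series this gives the one-sided derivatives of [w] at 0 and [L]. *)
Lemma derive_itvE (a b : R) (f g : R -> R) (x d : R) : a < b -> a <= x <= b ->
  (forall y, a <= y <= b -> f y = g y) -> is_derive x 1 g d ->
  derive_itv a b f x = d.
Proof.
move=> ab xab fg gd; have PF := dnbhs_itv_proper ab xab.
apply: cvg_lim; first exact: Rhausdorff.
apply/cvgrPdist_lt => e e0; have [r r0 H] := is_derive_near gd e0.
rewrite near_withinE near_withinE; exists r => // z /= xz zx.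
rewrite in_itv/= => zab; rewrite fg// fg// distrC mulrC.
have zE : x + (z - x) = z by ring.
have := H (z - x); rewrite zE subr_eq0; apply => //.
by rewrite distrC.
Qed.

Lemma heat_solution_hopf_cole (L M : R) (u0 : R -> R) (w : R -> R -> R) :
  hopf_cole_potential L M u0 w -> heat_solution L w.
Proof.
move=> H; split; first exact: hc_continuous H.
exists (fun x t => derive1 (w ^~ t) x), (fun x t => derive1n 2 (w ^~ t) x).
move=> x t xL t0; have [h1 h2 h3] := hc_derivable H xL t0; split.
- by rewrite derive1E; exact/derivableP.
- by rewrite /derive1n/= derive1E; exact/derivableP.
- by rewrite -(hc_heat H xL t0) derive1E; exact/derivableP.
Qed.

(** The lateral values are prescribed for positive times only. Continuity carries them to the
    corners, where the datum of the difference [v] must vanish for the density of sine polynomials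
    to apply. *)
Lemma continuous_lateral_value (L x C : R) (w : R -> R -> R) : 0 <= x <= L ->
  {within `[0, L] `*` `[0, +oo[, continuous (fun p : R * R => w p.1 p.2)} ->
  (forall t, 0 < t -> w x t = C) -> forall t, 0 <= t -> w x t = C.
Proof.
move=> xL /subspace_continuousP wc wC t; rewrite le_eqVlt => /predU1P[<-|/wC//].
apply/eqP; apply: contrapT => /negP wn.
have e0 : 0 < `|w x 0 - C| by rewrite normr_gt0 subr_eq0.
have K0 s : 0 <= s -> (`[0, L] `*` `[0, +oo[)%classic (x, s : R).
  by move=> s0; split; rewrite /= in_itv/= ?xL ?s0.
have /cvgrPdist_lt/(_ _ e0) := wc _ (K0 0 (lexx 0)).
rewrite near_withinE => wn'.
have c : continuous (fun s : R => (x, s)).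
  move=> s; apply: (@cvg_pair _ _ _ _ (nbhs x) (nbhs s)); last exact: cvg_id.
  exact: cvg_cst.
have : nbhs (0 : R) ((fun s : R => (x, s)) @^-1` _) := c 0 _ wn'.
move=> -[r /= r0 rP].
have r2 : 0 < r / 2 by rewrite divr_gt0.
have rr : r / 2 < r by lra.
have := rP (r / 2); rewrite /ball/= sub0r normrN gtr0_norm//.
by move=> /(_ rr (K0 _ (ltW r2))); rewrite /from_subspace/= (wC _ r2) ltxx.
Qed.

Theorem hopf_cole_uniform_cvg (L M : R) (u0 : R -> R) (w : R -> R -> R) :
  0 < L -> hopf_cole_potential L M u0 w ->
  {uniform `[0, L], (fun t x : R => hopf_cole L w x t) @ +oo --> U M L}.
Proof.
move=> L0 H; have wh := heat_solution_hopf_cole H.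
have [wc _] := wh.
set al := expR M - 1.
have LN0 : L != 0 by rewrite gt_eqF.
have w0 t : 0 <= t -> w 0 t = 1.
  apply: (continuous_lateral_value _ wc); last exact: hc_left H.
  by rewrite lexx ltW.
have wL t : 0 <= t -> w L t = expR M.
  apply: (continuous_lateral_value _ wc); last exact: hc_right H.
  by rewrite lexx ltW.
(* The subtracted affine function is the stationary solution with values 1 and e^M at the ends; its
   logarithmic derivative is [U M L]. *)
pose v (x t : R) := w x t - (1 + al / L * x).
have vh : heat_solution L v by exact/heat_solutionB/heat_solution_affine.
have v0 t : 0 <= t -> v 0 t = 0.
  by move=> /w0; rewrite /v => ->; rewrite mulr0 addr0 subrr.
have vL t : 0 <= t -> v L t = 0.
  by move=> /wL; rewrite /v => ->; rewrite divfK// /al; ring.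
have [b [B [bB vE]]] := heat_solution_sine_series L0 vh v0 vL.
set k := pi / L in vE.
have k0 : 0 < k by rewrite divr_gt0// pi_gt0.
have k20 : 0 < k ^+ 2 by rewrite exprn_gt0.
pose a (t : R) (n : nat) := b n * expR (- (n%:R ^+ 2 * (k ^+ 2 * t))).
have aB t : 4 <= k ^+ 2 * t -> forall n, `|a t n| * n%:R ^+ 2 <=
    (2 * B * expR (- (k ^+ 2 * t))) * 2^-1 ^+ n.
  by move=> t4; exact: sine_series_bound.
pose F (t x : R) := sine_series k (a t) x.
pose G (t x : R) := sine_series' k (a t) x.
have B0 : 0 <= B by rewrite (le_trans _ (bB 1%N _)).
pose K : R := 4 * B * (1 + k).
have [||C HC] := @quotient_rate R `[0, L]%classic F G (al / L)
  (fun x => 1 + al / L * x) (Num.min 1 (expR M)) (1 + `|al|) K _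
  (min1_expR_gt0 M) k20.
- move=> x; rewrite /= in_itv/= => /andP[x0 xL].
  rewrite -mulrA; have := @profile_denominator _ M (L^-1 * x); apply.
  by rewrite mulr_ge0 ?invr_ge0 ?(ltW L0)//= ler_pdivrMl// mulr1.
- near=> t => x _; have t4 : 4 <= k ^+ 2 * t.
    by rewrite -ler_pdivrMl//; near: t; exact: nbhs_pinfty_ge.
  have e0 := expR_ge0 (- (k ^+ 2 * t)).
  have Be0 := mulr_ge0 B0 e0; have Bek0 := mulr_ge0 Be0 (ltW k0).
  split; rewrite /F /G /K.
    rewrite (le_trans (sine_series_le _ (aB _ t4) _))//; lra.
  rewrite (le_trans (sine_series'_le _ (aB _ t4) _))// gtr0_norm//; lra.
apply: (uniform_cvg_expR (K := C) k20).
near=> t => x xL'; have t4 : 4 <= k ^+ 2 * t.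
  by rewrite -ler_pdivrMl//; near: t; exact: nbhs_pinfty_ge.
have xL : 0 <= x <= L by move: xL'; rewrite /= in_itv.
have wE y : 0 <= y <= L -> w y t = 1 + al / L * y + F t y.
  by move=> yL; rewrite /F -vE// /v; ring.
have dw : derive_itv 0 L (w ^~ t) x = al / L + G t x.
  apply: (derive_itvE L0 xL wE).
  have := is_deriveD (is_deriveD (is_derive_cst (1 : R) x 1)
    (is_derive_mull (al / L) x))
    (is_derive_sine_series k (aB _ t4) x).
  by rewrite add0r.
rewrite /hopf_cole dw wE//.
have -> : U M L x = (al / L) / (1 + al / L * x).
  rewrite /U -/al.
  have -> : L + al * x = L * (1 + al / L * x) by field.
  by rewrite invfM mulrA.
by move: x xL' {xL dw}; near: t.
Unshelve. all: by end_near. Qed.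

End interval_problem.

Theorem proposition3p4 (R : realType) (M : R) :
  [/\ {uniform `[0, 1],
        (fun c y : R => (Num.sqrt c)^-1 * Phi M c (y / Num.sqrt c)) @ +oo
          --> U M 1},
      exists C : R, \forall c \near +oo,
        (ereal_sup [set (`|(Num.sqrt c)^-1 * Phi M c (y / Num.sqrt c)
                           - U M 1 y|)%:E | y in `[0%R, 1%R]]
          <= (C * expR (- (pi ^+ 2 * c)))%:E)%E &
      forall (R0 L : R) (u0 : R -> R) (w : R -> R -> R),
        (@lebesgue_measure R).-integrable `]0, +oo[ (EFin \o u0) ->
        {ae @lebesgue_measure R, forall x, 0 < x -> R0 < x -> u0 x = 0} ->
        \int[@lebesgue_measure R]_(x in `]0, +oo[) u0 x = M ->
        0 < L -> R0 <= L ->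
        hopf_cole_potential L M u0 w ->
        {uniform `[0, L], (fun t x : R => hopf_cole L w x t) @ +oo
          --> U M L}].
Proof.
have [C HC] := Phi_rate M; split.
- by apply: (uniform_cvg_expR _ HC); rewrite exprn_gt0// pi_gt0.
- exists C; apply: filterS HC => c HC.
  by apply: ge_ereal_sup => _ [y y01 <-]; rewrite lee_fin; exact: HC.
- move=> R0 L u0 w _ _ _ L0 _; exact: hopf_cole_uniform_cvg.
Qed.
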